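(* Let $X$ be a Banach space whose dual $X^*$ is separable and has property $( * )$. Then for every $\varepsilon>0$, every non-trivial countably branching bundle graph, endowed with its graph distance, admits a (bi-)Lipschitz embedding into $X^*$ with distortion less than $6+\varepsilon$.
   Context: Let $T_n=\{\emptyset\}\cup\bigcup_{k=1}^n\mathbb N^k$; $|s|$ is the length of $s$, and $s_{|i}$ its initial segment of length $i$. For $t=(t_1,\dots,t_m)$ and $k\in\mathbb N$, $(t,k)$ denotes the sequence $(t_1,\dots,t_m,k)$ obtained by appending $k$ to $t$ (so $(\emptyset,k)=(k)$). A family $(x_s^* )_{s\in T_n}\subset X^*$ is weak$^*$-null if $w^*\text{-}\lim_k x^*_{(t,k)}=0$ for every $t\in T_{n-1}$ (where $T_0=\{\emptyset\}$). Let $B_{X^*}$ be the closed unit ball of $X^*$. Property $( * )$: there is $\varepsilon>0$ such that for all $n\ge1$ there is a weak$^*$-null family $(x_s^* )_{s\in T_n}\subset X^*$ with $x_\emptyset^*\in B_{X^*}$, $\|x_s^*\|\ge\varepsilon$ for all $s\ne\emptyset$, and $x_\emptyset^*+\sum_{i=1}^n\varepsilon_ix^*_{s_{|i}}\in B_{X^*}$ for all $s\in T_n$ with $|s|=n$ and all $\varepsilon_1,\dots,\varepsilon_n\in\{-1,1\}$. Bundle graphs. A top-bottom graph is a graph with two distinguished vertices, one designated as the top and the other as the bottom. A countably branching bundle graph is a top-bottom graph that can be formed, starting from a path of length $1$, by a finite sequence of the following operations: (i) given two countably branching bundle graphs, identify the top of one with the bottom of the other, the bottom of the first being the new bottom and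 the top of the second the new top; (ii) take countably infinitely many copies of a countably branching bundle graph and identify all the bottoms with each other and all the tops with each other. It is non-trivial if it is obtained by such a sequence with at least one operation (ii). A map $f:(M,d)\to X^*$ has distortion at most $D$ if there is $s>0$ with $s\,d(x,y)\le\|f(x)-f(y)\|\le sD\,d(x,y)$ for all $x,y\in M$. *)

(* Defs.v *)
From HB Require Import structures.
From mathcomp Require Import all_boot all_order all_algebra.
From mathcomp Require Import all_classical all_reals all_analysis.

Set Implicit Arguments.
Unset Strict Implicit.
Unset Printing Implicit Defensive.

Import Order.TTheory GRing.Theory Num.Theory.
Import numFieldNormedType.Exports.

Local Open Scope classical_set_scope.
Local Open Scope ring_scope.

Section DualSpace.
Context {R : realType} (X : normedModType R).

Definition is_dual_functional : {pred X -> R^o} :=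
  fun f => `[< linear f /\ continuous f >].

Record dual_space := DualSpace {
  dual_val :> X -> R^o;
  _ : dual_val \in is_dual_functional }.

HB.instance Definition _ := [isSub for dual_val].
HB.instance Definition _ := [Choice of dual_space by <:].

Lemma is_dual_functional_submod : submod_closed is_dual_functional.
Proof.
split.
  apply/asboolP; split; last exact: cst_continuous.
  by move=> a x y /=; rewrite scaler0 addr0.
move=> a f g /asboolP[lf cf] /asboolP[lg cg]; apply/asboolP; split.
  move=> b x y; rewrite !fctE lf lg !scalerDr !scalerA addrACA.
  by rewrite (mulrC a b).
move=> x; apply: cvgD; last exact: cg.
by apply: cvgZr; exact: cf.
Qed.

HB.instance Definition _ := GRing.isSubmodClosed.Build _ _ is_dual_functional
  is_dual_functional_submod.
HB.instance Definition _ := [SubChoice_isSubLmodule of dual_space by <:].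

Definition dual_norm (f : dual_space) : R :=
  sup [set `|f x| | x in [set x : X | `|x| <= 1]].

Lemma dual_linear (f : dual_space) : linear f.
Proof. by case: f => f /= /asboolP[]. Qed.

HB.instance Definition _ (f : dual_space) :=
  GRing.isLinear.Build R X R^o *:%R f (dual_linear f).

Lemma dual_continuous (f : dual_space) : continuous f.
Proof. by case: f => f /= /asboolP[]. Qed.

Lemma dual_norm_has_sup (f : dual_space) :
  has_sup [set `|f x| | x in [set x : X | `|x| <= 1]].
Proof.
split; first by exists `|f 0|, 0 => //=; rewrite normr0 ler01.
have /linear_boundedP/pinfty_ex_gt0[r r0 fr] : bounded_near f (nbhs 0).
  by apply: continuous_linear_bounded; exact: dual_continuous.
exists r => _ [x /= x1 <-]; rewrite (le_trans (fr x))//.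
by rewrite ler_piMr// ltW.
Qed.

Lemma dual_norm_ub (f : dual_space) (x : X) :
  `|x| <= 1 -> `|f x| <= dual_norm f.
Proof.
move=> x1; apply: ub_le_sup; first by case: (dual_norm_has_sup f).
by exists x.
Qed.

Lemma dual_norm_le (f : dual_space) (c : R) :
  (forall x : X, `|x| <= 1 -> `|f x| <= c) -> dual_norm f <= c.
Proof.
move=> fc; apply: ge_sup; first by case: (dual_norm_has_sup f).
by move=> _ [x /= x1 <-]; exact: fc.
Qed.

Lemma dual_normD (f g : dual_space) :
  dual_norm (f + g) <= dual_norm f + dual_norm g.
Proof.
apply: dual_norm_le => x x1; rewrite (le_trans (ler_normD _ _))//.
by rewrite lerD// dual_norm_ub.
Qed.

Lemma dual_normZ (a : R) (f : dual_space) :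
  dual_norm (a *: f) = `|a| * dual_norm f.
Proof.
have le (b : R) (g : dual_space) : dual_norm (b *: g) <= `|b| * dual_norm g.
  apply: dual_norm_le => x x1.
  by rewrite [X in `|X|](_ : _ = b * g x)// normrM ler_wpM2l// dual_norm_ub.
apply/eqP; rewrite eq_le le /=.
have [->|a0] := eqVneq a 0.
  rewrite normr0 mul0r (le_trans (normr_ge0 ((0 *: f) 0)))//.
  by rewrite dual_norm_ub// normr0.
rewrite -ler_pdivlMl ?normr_gt0// -normfV.
by have := le a^-1 (a *: f); rewrite scalerA mulVf// scale1r.
Qed.

Lemma dual_norm0_eq0 (f : dual_space) : dual_norm f = 0 -> f = 0.
Proof.
move=> f0; apply/val_inj/funext => x /=.
have [->|x0] := eqVneq x 0; first exact: linear0.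
have := @dual_norm_ub f (`|x|^-1 *: x).
rewrite normrZ normfV normr_id mulVf ?normr_eq0// lexx => /(_ isT).
rewrite linearZ/= normrZ normfV normr_id f0 pmulr_rle0 ?invr_gt0 ?normr_gt0//.
by rewrite normr_le0 => /eqP.
Qed.

HB.instance Definition _ := @Lmodule_isNormed.Build R dual_space
  dual_norm dual_normD dual_normZ dual_norm0_eq0.

End DualSpace.

Definition separable (T : topologicalType) : Prop :=
  exists A : set T, countable A /\ dense A.

(* The weak* topology of the dual is the topology of pointwise convergence. *)
Definition weak_star_cvg {R : realType} {X : normedModType R}
    (u : nat -> dual_space X) (l : dual_space X) : Prop :=
  {ptws, (fun k => u k : X -> R^o) @ \oo --> (l : X -> R^o)}.

(* T_n is the set of sequences of size at most n, (t, k) is [rcons t k] and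
   the initial segment of length i of s is [take i s].  Families indexed by
   T_n are functions on all sequences of which only the values on T_n matter. *)
Definition tree (n : nat) : set (seq nat) := [set s | (size s <= n)%N].

Definition weak_star_null {R : realType} {X : normedModType R} (n : nat)
    (x : seq nat -> dual_space X) : Prop :=
  forall t, tree n.-1 t -> weak_star_cvg (fun k => x (rcons t k)) 0.

Definition property_star {R : realType} (X : normedModType R) : Prop :=
  exists2 eps : R, 0 < eps &
    forall n : nat, (1 <= n)%N ->
      exists x : seq nat -> dual_space X,
        [/\ weak_star_null n x,
            `|x [::]| <= 1,
            forall s, tree n s -> s <> [::] -> eps <= `|x s| &
            forall s (sgn : nat -> R), size s = n ->
              (forall i, sgn i = 1 \/ sgn i = -1) ->
              `|x [::] + \sum_(1 <= i < n.+1) sgn i *: x (take i s)| <= 1].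

Record tb_graph := TBGraph {
  vertex : Type;
  adj : vertex -> vertex -> Prop;
  bottom : vertex;
  top : vertex }.

Definition tb_iso (G H : tb_graph) : Prop :=
  exists f : vertex G -> vertex H,
    [/\ bijective f,
        f (bottom G) = bottom H,
        f (top G) = top H &
        forall u v, adj u v <-> adj (f u) (f v)].

(* Construction sequences: [Edge] is the path of length 1, [Series a b]
   identifies the top of a with the bottom of b, [Branch a] takes nat many
   copies of a and identifies all the bottoms and all the tops.  The graphs
   are simple, so the parallel edges of [Branch Edge] are merged, which does
   not affect distances. *)
Inductive bundle_expr :=
  | Edge
  | Series of bundle_expr & bundle_expr
  | Branch of bundle_expr.

Fixpoint uses_branch (e : bundle_expr) : bool :=
  match e with
  | Edge => false
  | Series a b => uses_branch a || uses_branch b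
  | Branch _ => true
  end.

Inductive pointed2 (I : Type) := Bot | Top | Inner of I.
Arguments Bot {I}.
Arguments Top {I}.

(* Vertices other than the top and the bottom; in [Series a b] the [unit]
   summand is the vertex where the top of a meets the bottom of b. *)
Fixpoint inner_vertex (e : bundle_expr) : Type :=
  match e with
  | Edge => Empty_set
  | Series a b => (inner_vertex a + unit + inner_vertex b)%type
  | Branch a => (nat * inner_vertex a)%type
  end.

Definition expr_vertex (e : bundle_expr) : Type := pointed2 (inner_vertex e).

Definition series_low (a b : bundle_expr) (v : expr_vertex a) :
    expr_vertex (Series a b) :=
  match v with
  | Bot => Bot
  | Top => Inner (inl (inr tt))
  | Inner i => Inner (inl (inl i))
  end.

Definition series_high (a b : bundle_expr) (v : expr_vertex b) :
    expr_vertex (Series a b) :=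
  match v with
  | Bot => Inner (inl (inr tt))
  | Top => Top
  | Inner i => Inner (inr i)
  end.

Definition branch_copy (a : bundle_expr) (k : nat) (v : expr_vertex a) :
    expr_vertex (Branch a) :=
  match v with
  | Bot => Bot
  | Top => Top
  | Inner i => Inner (k, i)
  end.

Definition image_adj (U V : Type) (f : U -> V) (r : U -> U -> Prop) :
    V -> V -> Prop :=
  fun u v => exists u' v', [/\ r u' v', u = f u' & v = f v'].

Fixpoint expr_adj (e : bundle_expr) : expr_vertex e -> expr_vertex e -> Prop :=
  match e with
  | Edge => fun u v => (u = Bot /\ v = Top) \/ (u = Top /\ v = Bot)
  | Series a b => fun u v =>
      image_adj (@series_low a b) (@expr_adj a) u v \/
      image_adj (@series_high a b) (@expr_adj b) u v
  | Branch a => fun u v =>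
      exists k, image_adj (@branch_copy a k) (@expr_adj a) u v
  end.

Definition expr_graph (e : bundle_expr) : tb_graph :=
  TBGraph (@expr_adj e) Bot Top.

Definition nontrivial_bundle_graph (G : tb_graph) : Prop :=
  exists2 e, uses_branch e & tb_iso G (expr_graph e).

Inductive walk (G : tb_graph) : nat -> vertex G -> vertex G -> Prop :=
  | walk_nil u : walk 0 u u
  | walk_cons n u v w : adj u v -> walk n v w -> walk n.+1 u w.

(* The length of a shortest walk; the default 0 is only reached when there is
   no walk at all, which does not happen in a bundle graph. *)
Definition graph_dist (G : tb_graph) (u v : vertex G) : nat :=
  xget 0%N [set n | walk n u v /\ forall m, walk m u v -> (n <= m)%N].

Definition distortion_le {R : realType} {V : normedModType R} (M : Type)
    (d : M -> M -> R) (f : M -> V) (D : R) : Prop :=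
  exists2 s : R, 0 < s &
    forall x y, s * d x y <= `|f x - f y| <= s * D * d x y.

(* Main.v *)
Require Import Defs.
From HB Require Import structures.
From mathcomp Require Import all_boot all_order all_algebra.
From mathcomp Require Import all_classical all_reals all_analysis.
From mathcomp Require Import lra zify.

Set Implicit Arguments.
Unset Strict Implicit.
Unset Printing Implicit Defensive.

Import Order.TTheory GRing.Theory Num.Theory.
Import numFieldNormedType.Exports.

Local Open Scope classical_set_scope.
Local Open Scope ring_scope.

(** A vertex of a bundle graph sits inside a nested chain of copies, one for each
branching entered on the way to it.  Writing a copy as the sequence [s] of its
indices and the chosen vectors as [x s], the embedding is

  [f v = (level of v) x_[] + sum over the copies s around v of
         min (height above the bottom of s, height below its top) x_s].

Along an edge the level and each of the minima change by at most one, so the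
image of an edge is [a_0 x_[] + sum a_i x_(s|i)] with all [|a_i| <= 1], and this
lies in the unit ball as soon as all the signed sums along branches do: [f] is
1-Lipschitz ([bundle_emb_walk]).

Conversely two vertices [u], [v] are joined by a walk of length at most
[|level u - level v| + 2 c], where [c] is, up to sign, a coefficient of
[f u - f v] ([walk_coef]): either they lie on a common bottom-top path and
[c = 0], or they lie in two copies of the same bundle and the walk goes through
the nearer end of these copies.  If the vectors [x s], enumerated with parents
before children, behave like a monotone basic sequence with norms close to 1,
the level difference is at most about [|f u - f v|], because [x_[]] comes first,
and every other coefficient is at most about [2 |f u - f v|], being a
difference of two partial sums.  Hence the distance of [u] and [v] is at most
about [5 |f u - f v|], and the slack up to [6] absorbs the errors.

Vectors of norm close to 1 come from James' argument for the non-distortability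
of c_0.  Trees are replaced by iterated quantifiers of the form [in every weak*
neighbourhood of 0 there is an x such that ...] ([sign_game]).  If signed sums
of [m] consecutive vectors can be kept of norm at most [rho], dividing by [rho]
improves the lower bound [theta] to [theta / rho]; otherwise sums of blocks of
length [m] of norm at least [rho] are available and serve as new vectors
([sign_game_dichotomy]).  For [rho < 1] the first alternative cannot recur
forever, so every [rho < 1] is a possible lower bound
([sign_game_almost_isometric]).  Almost monotonicity is obtained by choosing
each vector nearly null at finitely many points that norm the combinations of
the earlier ones ([tree_selection]). *)

(** * Properties holding frequently near 0 in the weak* topology *)

Section WeakStarFrequently.
Context {R : realType} {X : normedModType R}.
Local Notation V := (dual_space X).
Implicit Types (P Q : V -> Prop) (F : seq X).

(** The sets [[set x | forall p, p \in F -> `|x p| <= eta]] form a basis of the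
weak* neighbourhoods of 0. *)
Definition frequently_null P : Prop :=
  forall F (eta : R), 0 < eta ->
    exists x : V, (forall p, p \in F -> `|x p| <= eta) /\ P x.

Lemma frequently_null_sub P Q :
  (forall x, P x -> Q x) -> frequently_null P -> frequently_null Q.
Proof.
move=> PQ fP F eta eta0; have [x [xF Px]] := fP F eta eta0.
by exists x; split=> //; exact: PQ.
Qed.

(** This stands for the stabilization of a two-valued colouring of a tree on a full
subtree: weak* neighbourhoods of 0 are directed, so if [P] fails on one of them
and [Q] on another, both fail on a third. *)
Lemma frequently_nullU P Q :
  frequently_null (fun x => P x \/ Q x) -> frequently_null P \/ frequently_null Q.
Proof.
move=> fPQ; apply: contrapT => /not_orP[].
move=> /existsNP[F1 /existsNP[e1 /not_implyP[e10 nP]]].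
move=> /existsNP[F2 /existsNP[e2 /not_implyP[e20 nQ]]].
have e0 : 0 < Num.min e1 e2 by rewrite lt_min e10.
have [x [xF PQx]] := fPQ (F1 ++ F2) _ e0.
have xF1 p : p \in F1 -> `|x p| <= e1.
  by move=> pF; rewrite (le_trans (xF p _))// ?mem_cat ?pF// ge_min lexx.
have xF2 p : p \in F2 -> `|x p| <= e2.
  by move=> pF; rewrite (le_trans (xF p _))// ?mem_cat ?pF ?orbT// ge_min lexx orbT.
by case: PQx => [Px|Qx]; [apply: nP; exists x|apply: nQ; exists x].
Qed.

Lemma frequently_nullZ (a : R) P : a != 0 ->
  frequently_null P -> frequently_null (fun x => P (a *: x)).
Proof.
move=> a0 fP F eta eta0.
have na0 : 0 < `|a| by rewrite normr_gt0.
have [x [xF Px]] := fP F _ (mulr_gt0 na0 eta0).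
exists (a^-1 *: x); split; last by rewrite scalerA divff// scale1r.
move=> p pF; rewrite [X in `|X|](_ : _ = a^-1 * x p)//.
by rewrite normrM normfV ler_pdivrMl// xF.
Qed.

Lemma frequently_null_seq (u : nat -> V) P :
  weak_star_cvg u 0 -> (forall k, P (u k)) -> frequently_null P.
Proof.
move=> /pointwise_cvgP u0 Pu F eta eta0.
have : \forall k \near \oo, forall p, p \in F -> `|u k p| <= eta.
  elim: F => [|q F IH]; first by near=> k.
  have /cvgrPdist_le/(_ _ eta0) := u0 q; apply: filterS2 IH => k uF uq p.
  rewrite inE => /orP[/eqP->|]; last exact: uF.
  by rewrite [X in X <= _](_ : _ = `|(0 : V) q - u k q|) ?[in RHS]sub0r ?normrN.
move=> [N _ /(_ N (leqnn N)) uN].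
by exists (u N).
Unshelve. all: by end_near. Qed.

End WeakStarFrequently.

(** * Unconditionally bounded trees and James' blocking argument *)

Section SignGame.
Context {R : realType} {X : normedModType R}.
Local Notation V := (dual_space X).
Implicit Types (K L : set V) (x y z : V).

Definition signed_shift K x : set V := [set z | K (z - x) \/ K (z + x)].

(** The vectors of a weak*-null tree of height [n] are picked one after the other,
each as close to 0 as an opponent requires; [K] collects the signed sums of
the vectors picked so far. *)
Fixpoint sign_game (theta rho : R) (n : nat) K : Prop :=
  match n with
  | 0 => forall z, K z -> `|z| <= rho
  | n.+1 => frequently_null
      (fun x => theta <= `|x| /\ sign_game theta rho n (signed_shift K x))
  end.

Lemma signed_shift_sub K L x : K `<=` L -> signed_shift K x `<=` signed_shift L x.
Proof. by move=> KL z [/KL|/KL]; [left|right]. Qed.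

Lemma sign_game_sub theta rho n K L :
  K `<=` L -> sign_game theta rho n L -> sign_game theta rho n K.
Proof.
elim: n K L => [|n IH] K L KL /= H; first by move=> z /KL/H.
apply: frequently_null_sub H => x [? H]; split=> //.
by apply: IH H; exact: signed_shift_sub.
Qed.

Lemma sign_game_le theta theta' rho n K : theta' <= theta ->
  sign_game theta rho n K -> sign_game theta' rho n K.
Proof.
move=> le; elim: n K => [//|n IH] K /=.
apply: frequently_null_sub => x [xt H]; split; last exact: IH.
exact: le_trans xt.
Qed.

Lemma norm_mid x z (rho : R) :
  `|z + x| <= rho -> `|z - x| <= rho -> `|z| <= rho.
Proof.
move=> H1 H2.
have -> : z = 2^-1 *: ((z + x) + (z - x)).
  by rewrite addrACA subrr addr0 -mulr2n -[z *+ 2]scaler_nat scalerA mulVf ?scale1r.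
rewrite normrZ gtr0_norm ?invr_gt0//.
rewrite ler_pdivrMl// (le_trans (ler_normD _ _))//; lra.
Qed.

(** Each [z] in [K] is the midpoint of two signed sums at the next level. *)
Lemma sign_game_bounded theta rho n K z :
  sign_game theta rho n K -> K z -> `|z| <= rho.
Proof.
elim: n K z => [|n IH] K z /=; first exact.
move=> /(_ [::] 1 ltr01)[x [_ [_ H]]] Kz.
by apply: (@norm_mid x); apply: IH H _; [left|right]; rewrite ?addrK ?subrK.
Qed.

Lemma sign_game_scale theta rho n K : 0 < rho ->
  sign_game theta rho n K ->
  sign_game (theta / rho) 1 n [set z | K (rho *: z)].
Proof.
move=> rho0; elim: n K => [|n IH] K /=.
  move=> H z /H; rewrite normrZ gtr0_norm//.
  by rewrite -ler_pdivlMl// mulVf ?gt_eqF.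
move=> /(frequently_nullZ (lt0r_neq0 rho0)); apply: frequently_null_sub => x.
move=> [xt /IH H]; split.
  by rewrite ler_pdivrMr// mulrC -{1}(gtr0_norm rho0) -normrZ.
apply: sign_game_sub H => z; rewrite /signed_shift /= scalerBr scalerDr.
by [].
Qed.

Definition sumset K L : set V := [set z | exists2 k, K k & L (z - k)].

(** [K] collects the signed sums of the vectors before the current block, [L] those
within the block, of which [m] vectors are still to come.  When the block is
complete one of its signed sums must have norm at least [rho], and the game
must go on for [r] moves from all the signed sums together. *)
Fixpoint block_game (theta rho : R) (r m : nat) K L : Prop :=
  match m with
  | 0 => (exists2 y, L y & rho <= `|y|) /\ sign_game theta 1 r (sumset K L)
  | m.+1 => frequently_null (fun x => block_game theta rho r m K (signed_shift L x))
  end.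

Lemma sumset_signed_shift K L x : sumset K (signed_shift L x) `<=` signed_shift (sumset K L) x.
Proof.
move=> z [k Kk [H|H]]; [left|right]; exists k => //.
  by rewrite addrAC.
by rewrite addrAC.
Qed.

(** When a block is over, its signed sums are either all of norm at most [rho], or
one of them is not; [frequently_nullU] carries this alternative back to the
start of the block. *)
Lemma sign_game_split theta rho r m K L :
  sign_game theta 1 (m + r) (sumset K L) ->
  sign_game theta rho m L \/ block_game theta rho r m K L.
Proof.
elim: m L => [|m IH] L /=.
  move=> H; have [HL|/existsNP[y /not_implyP[Ly /negP]]] :=
    pselect (forall z, L z -> `|z| <= rho); first by left.
  by rewrite -ltNge => /ltW ly; right; split=> //; exists y.
move=> H; apply: frequently_nullU; apply: frequently_null_sub H => x [xt H].
have /IH[H'|H'] : sign_game theta 1 (m + r) (sumset K (signed_shift L x)).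
  by apply: sign_game_sub H; exact: sumset_signed_shift.
- by left.
- by right.
Qed.

(** A signed sum [y] of a block is weak* small because all its terms are, and
replacing the block by [y] only discards signed sums, since [L] is symmetric. *)
Lemma block_game_extract theta rho r m K L (F : seq X) (c eta : R) :
  (forall l, L l -> L (- l)) ->
  (forall l, L l -> forall p, p \in F -> `|l p| <= c) -> 0 < eta ->
  block_game theta rho r m K L ->
  exists y, [/\ forall p, p \in F -> `|y p| <= c + m%:R * eta,
                rho <= `|y| & sign_game theta 1 r (signed_shift K y)].
Proof.
move=> + + eta0; elim: m c L => [|m IH] c L symL cL /=.
  move=> [[y Ly yrho] H]; exists y; split=> //.
    by move=> p pF; rewrite mul0r addr0 cL.
  apply: sign_game_sub H => z [Kz|Kz]; [exists (z - y)|exists (z + y)] => //.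
    by rewrite subKr.
  by rewrite opprD addrA subrr add0r; exact: symL.
move=> /(_ F eta eta0)[x [xF H]].
have [|l lL p pF|y [yF yrho Hy]] := IH (c + eta) (signed_shift L x) _ _ H.
- move=> l [/symL|/symL]; rewrite ?opprB ?opprD; [right|left] => //.
  by rewrite addrC.
- have lp (a b : V) : (a + b) p = a p + b p by [].
  have np (a : V) : (- a) p = - a p by [].
  case: lL => /cL/(_ p pF); rewrite lp ?np => lx.
    rewrite -[l p](subrK (x p)) (le_trans (ler_normD _ _))// lerD// xF//.
  rewrite -[l p](addrK (x p)) (le_trans (ler_normD _ _))// lerD// normrN xF//.
- by exists y; split=> // p /yF/le_trans; apply; rewrite -natr1 mulrDl mul1r; lra.
Qed.

(** A block whose signed sums cannot all be small is traded for one vector of norm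
at least [rho]. *)
Lemma sign_game_block theta rho r m K :
  sign_game theta 1 (m + r) K -> ~ sign_game theta rho m [set 0] ->
  frequently_null (fun y => rho <= `|y| /\ sign_game theta 1 r (signed_shift K y)).
Proof.
move=> H nH F eta eta0.
have /(@sign_game_split _ rho)[//|H'] : sign_game theta 1 (m + r) (sumset K [set 0]).
  by apply: sign_game_sub H => z [k Kk /= /eqP]; rewrite subr_eq0 => /eqP->.
have e0 : 0 < eta / m.+1%:R by rewrite divr_gt0.
have [l -> /=|l -> p pF|y [yF yrho Hy]] :=
  block_game_extract (F := F) (c := 0) _ _ e0 H'.
- by rewrite oppr0.
- by rewrite [X in `|X|](_ : _ = 0)// normr0.
exists y; split=> // p /yF/le_trans; apply.
rewrite add0r mulrCA ger_pMr// ler_pdivrMr// mul1r ler_nat//.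
Qed.

Lemma sign_game_blocks theta rho m n K : ~ sign_game theta rho m [set 0] ->
  sign_game theta 1 (n * m) K -> sign_game rho 1 n K.
Proof.
move=> nH; elim: n K => [//|n IH] K; rewrite mulSn => /sign_game_block/(_ nH).
by apply: frequently_null_sub => y [yrho /IH].
Qed.

(** If the game with lower bound [rho] is lost at height [n] and the one with
[theta / rho] at height [m], then blocks of length [m] contradict the
hypothesis at height [n * m]. *)
Lemma sign_game_dichotomy theta rho : 0 < rho ->
  (forall n, sign_game theta 1 n [set 0]) ->
  (forall n, sign_game rho 1 n [set 0]) \/
  (forall n, sign_game (theta / rho) 1 n [set 0]).
Proof.
move=> rho0 H; apply: contrapT => /not_orP[/existsNP[n nn] /existsNP[m nm]].
apply: nn; apply: (@sign_game_blocks theta rho m) => //.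
move=> /(sign_game_scale rho0) Hm; apply: nm; apply: sign_game_sub Hm.
by move=> z /= ->; rewrite scaler0.
Qed.

(** Otherwise the dichotomy, applied again and again with [rho = theta], yields the
lower bounds [theta0 / theta ^+ k]; for large [k] these exceed 1, which is
absurd since the vectors lie in the unit ball. *)
Lemma sign_game_almost_isometric theta0 theta : 0 < theta0 -> theta < 1 ->
  (forall n, sign_game theta0 1 n [set 0]) ->
  forall n, sign_game theta 1 n [set 0].
Proof.
move=> theta00 theta1 H.
have [theta_gt0|theta_le0] := ltP 0 theta; last first.
  by move=> n; apply: sign_game_le (H n); rewrite (le_trans theta_le0)// ltW.
apply: contrapT => nH.
have Hk k n : sign_game (theta0 / theta ^+ k) 1 n [set 0].
  elim: k n => [|k IH] n; first by rewrite expr0 divr1.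
  have [//|H'] := sign_game_dichotomy theta_gt0 IH.
  by rewrite exprS [theta * _]mulrC invfM mulrA.
have [k] : exists k, theta ^+ k < theta0.
  have : (fun k => theta ^+ k) @ \oo --> (0 : R).
    by apply: cvg_expr; rewrite gtr0_norm.
  move=> /cvgr_lt/(_ _ theta00)[k _ /(_ k (leqnn k)) ?]; by exists k.
have tk : 0 < theta ^+ k by rewrite exprn_gt0.
move=> lek; have /= := Hk k 1%N => /(_ [::] 1 ltr01)[x [_ [xge]]].
move=> /(_ x); rewrite /signed_shift /= subrr => /(_ (or_introl erefl)) x1.
have := le_trans xge x1; rewrite ler_pdivrMr// mul1r => /(lt_le_trans lek).
by rewrite ltxx.
Qed.

End SignGame.

(** * From weak*-null trees to games *)

Section PropertyStarGame.
Context {R : realType} {X : normedModType R}.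
Local Notation V := (dual_space X).

(** The root of the given tree is averaged out: a signed sum [z] of the other
vectors is the midpoint of [x [::] + z] and [z - x [::]]. *)
Lemma property_star_sign_game : property_star X ->
  exists2 e : R, 0 < e & forall n, sign_game e 1 n [set (0 : V)].
Proof.
case=> e e0 starX; exists e => // -[|n].
  by move=> z -> /=; rewrite normr0.
have [x [x_null x0 x_ge x_le]] := starX n.+1 isT.
pose K (t : seq nat) : set V := [set z | exists2 sgn : nat -> R,
  (forall i, sgn i = 1 \/ sgn i = -1) &
  z = \sum_(1 <= i < (size t).+1) sgn i *: x (take i t)].
suff H k t : (size t + k = n.+1)%N -> sign_game e 1 k (K t).
  apply: sign_game_sub (H n.+1 [::] _) => // z ->; exists (fun=> 1); first by left.
  by rewrite big_geq.
elim: k t => [|k IH] t.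
  rewrite addn0 => tn z [sgn sgn1 ->].
  apply: (@norm_mid _ _ (x [::])); first by rewrite addrC tn x_le.
  rewrite -normrN opprB -sumrN.
  under eq_bigr do rewrite -scaleNr.
  rewrite tn (x_le t (fun i => - sgn i))// => i.
  by case: (sgn1 i) => ->; [right|left]; rewrite ?opprK.
rewrite addnS => -[tn] /=.
apply: (@frequently_null_seq _ _ (fun j => x (rcons t j))).
  by apply: x_null; rewrite /tree /= -tn leq_addr.
move=> j; split.
  apply: x_ge; last by case: (t).
  by rewrite /tree /= size_rcons ltnS -tn leq_addr.
apply: sign_game_sub (IH (rcons t j) _); last by rewrite size_rcons addSn tn.
have ext (a : R) sgn z : (forall i, sgn i = 1 \/ sgn i = -1) -> a = 1 \/ a = -1 ->
    z = \sum_(1 <= i < (size t).+1) sgn i *: x (take i t) ->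
    K (rcons t j) (z + a *: x (rcons t j)).
  move=> sgn1 a1 ->; exists (fun i => if i == (size t).+1 then a else sgn i).
    by move=> i; case: ifP.
  rewrite size_rcons [RHS]big_nat_recr//= eqxx take_oversize ?size_rcons//.
  congr (_ + _); apply: eq_big_nat => i /andP[_ it].
  rewrite ltn_eqF//; congr (_ *: x _); rewrite ltnS in it.
  by rewrite -cats1 takel_cat.
move=> z [] [sgn sgn1 zE].
  by rewrite -[z](subrK (x (rcons t j))) -[X in _ + X]scale1r; apply: ext zE => //; left.
by rewrite -[z](addrK (x (rcons t j))) -[- x _]scaleN1r; apply: ext zE => //; right.
Qed.

End PropertyStarGame.

(** * Selection of an almost monotone tree *)

Section History.
Context {T : Type} (P : seq T -> T -> Prop).

(** Dependent choice where the next term is constrained by all the previous ones,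
and a step need only be possible after a history of legal steps. *)
Lemma history_choice :
  (forall h, (forall k x0, (k < size h)%N -> P (take k h) (nth x0 h k)) ->
    exists x, P h x) ->
  exists x : nat -> T, forall k, P (mkseq x k) (x k).
Proof.
move=> H.
have [d _] : exists x, P [::] x by apply: H.
have [c cP] : {c : seq T -> T & forall h, (exists x, P h x) -> P h (c h)}.
  apply: (@choice _ _ (fun h y => (exists x, P h x) -> P h y)) => h.
  have [[x Px]|nP] := pselect (exists x, P h x); first by exists x.
  by exists d.
pose hist k := iter k (fun h => rcons h (c h)) [::].
pose x k := c (hist k).
have histE k : hist k = mkseq x k by elim: k => // k IH; rewrite mkseqS -IH.
exists x => k; elim/ltn_ind: k => k IH; rewrite {2}/x histE.
apply: cP; apply: H => j x0; rewrite size_mkseq => jk.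
rewrite nth_mkseq// /mkseq -map_take take_iota (minn_idPl (ltnW jk)).
exact: IH.
Qed.

End History.

Section Boxes.
Context {R : realType} {V : normedModType R}.

Lemma norm_segment (u x : V) (a : R) :
  `|u + x| <= 1 -> `|u - x| <= 1 -> `|a| <= 1 -> `|u + a *: x| <= 1.
Proof.
rewrite [`|a| <= _]ler_norml => up um /andP[a1 a2].
have -> : u + a *: x = ((1 + a) / 2) *: (u + x) + ((1 - a) / 2) *: (u - x).
  rewrite !scalerDr addrACA -scalerDl scalerN -scalerBl.
  by congr (_ + _); [rewrite -[LHS]scale1r|]; congr (_ *: _); lra.
rewrite (le_trans (ler_normD _ _))// !normrZ !ger0_norm; try lra.
have : (1 + a) / 2 * `|u + x| <= (1 + a) / 2 by apply: ler_piMr => //; lra.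
have : (1 - a) / 2 * `|u - x| <= (1 - a) / 2 by apply: ler_piMr => //; lra.
lra.
Qed.

(** Sequences are read from the end: the parent of [m :: s] is [s], and the branch
ending in [s] runs through its suffixes. *)
Fixpoint branch_box (x : seq nat -> V) (s : seq nat) : set V :=
  [set z + a *: x s | z in (if s is _ :: s' then branch_box x s' else [set 0])
                    & a in [set a | `|a| <= 1]].

End Boxes.

Section Selection.
Context {R : realType} {X : normedModType R}.
Local Notation V := (dual_space X).
Implicit Types (x : seq nat -> V) (s : seq nat) (h : seq V).

Lemma norming_point (y : V) (d : R) : 0 < d ->
  exists w : X, `|w| <= 1 /\ `|y| - d <= `|y w|.
Proof.
move=> d0; have [_ [w w1 <-] /ltW lt] := sup_adherent d0 (dual_norm_has_sup y).
by exists w.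
Qed.

Fixpoint branch_sums x s : set V :=
  signed_shift (if s is _ :: s' then branch_sums x s' else [set 0]) (x s).

(** The points of the box are convex combinations of the signed sums.  The vector [v] is what
convexity has to carry through the induction along the branch. *)
Lemma branch_box_bounded x s (v : V) :
  (forall z, branch_sums x s z -> `|z + v| <= 1) ->
  forall z, branch_box x s z -> `|z + v| <= 1.
Proof.
elim: s v => [|m s IH] v H z /= [z' z'K [a a1 <-]].
  rewrite z'K add0r addrC; apply: norm_segment => //; rewrite addrC H//=.
    by left; rewrite subrr.
  by right; rewrite addNr.
rewrite -addrA; apply: IH z'K => w wK.
rewrite addrCA addrC; apply: norm_segment => //; rewrite addrAC H//=.
  by left; rewrite addrK.
by right; rewrite subrK.
Qed.

(** The [0] at every stage stands for stopping there, so combinations of all initial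
segments of [h] are listed. *)
Fixpoint prefix_combos (A : seq R) h : seq V :=
  if h is v :: h' then 0 :: [seq a *: v + y | a <- A, y <- prefix_combos A h']
  else [:: 0].

Lemma mem_prefix_combos (A : seq R) h (c : nat -> R) j :
  (forall i, c i \in A) -> (j <= size h)%N ->
  \sum_(i < j) c i *: nth 0 h i \in prefix_combos A h.
Proof.
elim: h c j => [|v h IH] c [|j] cA //= jh; rewrite ?big_ord0 ?inE ?eqxx//.
apply/orP; right; rewrite big_ord_recl; apply: allpairs_f => //.
exact: (IH (fun i => c i.+1)).
Qed.

(** [CodeSeq.code] is a bijection from sequences to numbers which enumerates parents
before children. *)
Lemma ltn_code_cons m s : (CodeSeq.code s < CodeSeq.code (m :: s))%N.
Proof.
have m0 : (0 < 2 ^ m)%N by rewrite expn_gt0.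
rewrite /= (@leq_trans (CodeSeq.code s).*2.+1)//; last exact: leq_pmull.
by rewrite ltnS -addnn leq_addr.
Qed.

Lemma branch_sums_eq x x' s :
  (forall t, (CodeSeq.code t <= CodeSeq.code s)%N -> x t = x' t) ->
  branch_sums x s = branch_sums x' s.
Proof.
elim: s => [|m s IH] H /=; first by rewrite H.
rewrite H// IH// => t ts; apply: H; apply: leq_trans ts _.
exact: ltnW (ltn_code_cons m s).
Qed.

(** [h] lists the vectors at the nodes of codes below [size h], and [v] is to be put
at the node [s] of code [size h].  Reading [h] with default value [v] makes [v]
the value at [s] itself. *)
Definition good_step (theta : R) n (wit : V -> X) (A : seq R) (eta : nat -> R)
    h (v : V) : Prop :=
  let s := CodeSeq.decode (size h) in
  ((size s <= n)%N -> theta <= `|v| /\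
    sign_game theta 1 (n - size s)
      (branch_sums (fun t => nth v h (CodeSeq.code t)) s)) /\
  forall y, y \in prefix_combos A h -> `|v (wit y)| <= eta (size h).

(** The parent of the new node comes earlier and left a game that can be continued.
Nodes too deep for the game receive the vector 0. *)
Lemma good_step_ex theta n wit A eta h : (forall k, 0 < eta k) ->
  sign_game theta 1 n.+1 [set (0 : V)] ->
  (forall k v0, (k < size h)%N ->
    good_step theta n wit A eta (take k h) (nth v0 h k)) ->
  exists v, good_step theta n wit A eta h v.
Proof.
move=> eta0 H hgood; rewrite /good_step.
set s := CodeSeq.decode (size h).
have sh : CodeSeq.code s = size h by rewrite CodeSeq.decodeK.
have [sn|sn] := leqP (size s) n; last first.
  by exists 0; split=> // y _; rewrite [X in `|X|](_ : _ = 0)// normr0 ltW.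
pose K := if s is _ :: s' then
  branch_sums (fun t => nth (0 : V) h (CodeSeq.code t)) s' else [set (0 : V)].
have /(_ [seq wit y | y <- prefix_combos A h] _ (eta0 (size h)))[v [v_small [v_ge vK]]] :
    frequently_null (fun v : V => theta <= `|v| /\
      sign_game theta 1 (n - size s) (signed_shift K v)).
  rewrite {}/K; case: (s) sh sn => [|m s'] sh sn; first by rewrite subn0.
  have s'h : (CodeSeq.code s' < size h)%N by rewrite -sh ltn_code_cons.
  have [+ _] := hgood _ 0 s'h.
  rewrite size_take s'h CodeSeq.codeK => /(_ (ltnW sn))[_].
  rewrite subnS -(@prednK (n - size s')) ?subn_gt0//=.
  rewrite -(@branch_sums_eq (fun t => nth 0 h (CodeSeq.code t)))// => t.
  rewrite leq_eqVlt => /orP[/eqP ->|ts]; last first.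
    by rewrite nth_take//; apply: set_nth_default; apply: ltn_trans s'h.
  by rewrite [RHS]nth_default// size_take s'h.
exists v; split; last by move=> y yh; apply: v_small; exact: map_f.
move=> _; split => //.
suff <- : signed_shift K v = branch_sums (fun t => nth v h (CodeSeq.code t)) s by [].
rewrite {v_small v_ge vK}/K; case: (s) sh => [|m s'] sh.
  by rewrite /= nth_default// -sh.
rewrite -[RHS]/(signed_shift (branch_sums (fun t => nth v h (CodeSeq.code t)) s')
                   (nth v h (CodeSeq.code (m :: s')))) nth_default ?sh//.
congr (signed_shift _ v); apply: branch_sums_eq => t ts.
by apply: set_nth_default; rewrite -sh (leq_ltn_trans ts)// ltn_code_cons.
Qed.

(** If the partial sum up to [j] is normed at [w] up to [delta / 2], the later
terms are at most [delta / 2 * 2^-1 ^+ k] at [w], with distinct [k >= 1], so they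
cannot lower the norm by more than another [delta / 2].  The finite set [A] of
coefficients keeps the set of points to be controlled finite. *)
Lemma tree_selection theta n (A : seq R) (delta : R) : 0 < delta ->
  sign_game theta 1 n.+1 [set (0 : V)] ->
  exists x : nat -> V,
    [/\ forall s, (size s <= n)%N -> theta <= `|x (CodeSeq.code s)|,
        forall s z, (size s <= n)%N ->
          branch_box (x \o CodeSeq.code) s z -> `|z| <= 1 &
        forall c : nat -> R, (forall i, c i \in A) ->
          forall j N, (j <= N)%N ->
          `|\sum_(i < j) c i *: x i| <= `|\sum_(i < N) c i *: x i| + delta].
Proof.
move=> delta0 H.
have d20 : 0 < delta / 2 by rewrite divr_gt0.
have [wit witP] := choice (fun y : V => norming_point y d20).
(* [C] bounds the coefficients; the summand 1 only makes it positive. *)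
pose C := 1 + \sum_(a <- A) `|a|.
have C0 : 0 < C by rewrite ltr_pwDl// sumr_ge0.
have CA a : a \in A -> `|a| <= C.
  move=> aA; rewrite /C (big_rem a)//= addrCA lerDl addr_ge0// sumr_ge0//.
pose eta k : R := delta / 2 / C * 2^-1 ^+ k.+1.
have eta0 k : 0 < eta k by rewrite !mulr_gt0// ?invr_gt0// exprn_gt0// invr_gt0.
have [x xP] := history_choice (fun h => @good_step_ex theta n wit A eta h eta0 H).
have nthx k t : (CodeSeq.code t <= k)%N ->
    nth (x k) (mkseq x k) (CodeSeq.code t) = x (CodeSeq.code t).
  rewrite leq_eqVlt => /orP[/eqP->|tk]; last by rewrite nth_mkseq.
  by rewrite nth_default// size_mkseq.
exists x; split.
- move=> s sn; have [+ _] := xP (CodeSeq.code s).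
  by rewrite size_mkseq CodeSeq.codeK => /(_ sn)[].
- move=> s z sn; rewrite -[z in `|z|]addr0; apply: branch_box_bounded => {}z.
  have [+ _] := xP (CodeSeq.code s).
  rewrite size_mkseq CodeSeq.codeK => /(_ sn)[_].
  rewrite (@branch_sums_eq _ (x \o CodeSeq.code)) => [Hs zs|t /nthx//].
  by rewrite addr0; exact: sign_game_bounded Hs zs.
move=> c cA j N jN.
pose S k : V := \sum_(i < k) c i *: x i; rewrite -!/(S _).
pose w := wit (S j).
have [w1 Sw] := witP (S j).
have step m : `|S j w| <= `|S (j + m)%N w| + delta / 2 * (1 - 2^-1 ^+ m).
  elim: m => [|m IH]; first by rewrite addn0 expr0 subrr mulr0 addr0.
  have xw : `|c (j + m)%N * x (j + m)%N w| <= delta / 2 * 2^-1 ^+ m.+1.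
    rewrite normrM (@le_trans _ _ (C * eta (j + m)%N))//.
      apply: ler_pM => //; first exact: CA.
      have [_] := xP (j + m)%N; rewrite size_mkseq; apply.
      have -> : S j = \sum_(i < j) c i *: nth 0 (mkseq x (j + m)) i.
        apply: eq_bigr => i _; rewrite nth_mkseq//.
        by rewrite (leq_trans (ltn_ord i))// leq_addr.
      by apply: mem_prefix_combos; rewrite ?size_mkseq ?leq_addr.
    rewrite /eta mulrA [C * _]mulrC divfK ?gt_eqF//.
    rewrite ler_wpM2l ?(ltW d20)// ler_wiXn2l ?invr_ge0 ?invf_le1 ?ler1n//.
    by rewrite ltnS leq_addl.
  have SS : S (j + m.+1)%N w = S (j + m)%N w + c (j + m)%N * x (j + m)%N w.
    by rewrite /S addnS big_ord_recr.
  have := ler_normB (S (j + m.+1)%N w) (c (j + m)%N * x (j + m)%N w).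
  rewrite {1}SS addrK => le2.
  move: IH xw le2; rewrite exprS; set a := 2^-1 ^+ m; lra.
have SN : `|S N w| <= `|S N| by apply: dual_norm_ub.
have := step (N - j)%N; rewrite subnKC// => stepN.
have : 0 <= delta / 2 * 2^-1 ^+ (N - j) by rewrite mulr_ge0 ?ltW// exprn_ge0// invr_ge0.
by rewrite -/w in Sw; lra.
Qed.

End Selection.

(** * Levels and coefficients in bundle graphs *)

Section BundleExpr.
Implicit Types (e a b : bundle_expr) (s t : seq nat).

Fixpoint height e : nat :=
  match e with
  | Edge => 1
  | Series a b => height a + height b
  | Branch a => height a
  end.

Fixpoint nesting e : nat :=
  match e with
  | Edge => 0
  | Series a b => maxn (nesting a) (nesting b)
  | Branch a => (nesting a).+1
  end.

Fixpoint inner_level e : inner_vertex e -> nat :=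
  match e with
  | Edge => fun _ => 0%N
  | Series a b => fun i => match i with
      | inl (inl i) => inner_level i
      | inl (inr _) => height a
      | inr i => (height a + inner_level i)%N
      end
  | Branch a => fun i => inner_level i.2
  end.

Definition level e (v : expr_vertex e) : nat :=
  match v with Bot => 0%N | Top => height e | Inner i => inner_level i end.

(** The distance from level [k] to the nearer end of a bundle of height [h]. *)
Definition tent (h k : nat) : nat := minn k (h - k).

(** The coefficient at [x t] of the embedding of a vertex of a bundle lying inside
the copy coded by [s].  Bundles in series use the same codes: vertices that
belong to different ones are at vertical distance, which the levels detect. *)
Fixpoint inner_coef e s : inner_vertex e -> seq nat -> nat :=
  match e with
  | Edge => fun _ _ => 0%N
  | Series a b => fun i => match i with
      | inl (inl i) => inner_coef s i
      | inl (inr _) => fun=> 0%N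
      | inr i => inner_coef s i
      end
  | Branch a => fun i t =>
      (tent (height a) (inner_level i.2) * (t == i.1 :: s)
       + inner_coef (i.1 :: s) i.2 t)%N
  end.

Definition coef e s (v : expr_vertex e) t : nat :=
  if v is Inner i then inner_coef s i t else 0%N.

Definition total_coef e (v : expr_vertex e) t : nat :=
  (level v * (t == [::]) + coef [::] v t)%N.

Lemma level_low a b (u : expr_vertex a) : level (series_low b u) = level u.
Proof. by case: u. Qed.

Lemma level_high a b (u : expr_vertex b) : level (series_high a u) = (height a + level u)%N.
Proof. by case: u => //=; rewrite addn0. Qed.

Lemma level_copy a k (u : expr_vertex a) : level (branch_copy k u) = level u.
Proof. by case: u. Qed.

Lemma coef_low a b s (u : expr_vertex a) : coef s (series_low b u) = coef s u.
Proof. by case: u. Qed.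

Lemma coef_high a b s (u : expr_vertex b) : coef s (series_high a u) = coef s u.
Proof. by case: u. Qed.

Lemma tent0 h : tent h 0 = 0%N. Proof. by rewrite /tent min0n. Qed.

Lemma tenthh h : tent h h = 0%N. Proof. by rewrite /tent subnn minn0. Qed.

Lemma coef_copy a k s (u : expr_vertex a) t : coef s (branch_copy k u) t =
  (tent (height a) (level u) * (t == k :: s) + coef (k :: s) u t)%N.
Proof. by case: u => //=; rewrite ?tent0 ?tenthh mul0n. Qed.

Lemma series_vertexP a b (w : expr_vertex (Series a b)) :
  (exists u, w = series_low b u) \/ (exists u, w = series_high a u).
Proof.
case: w => [||[[i|[]]|i]].
- by left; exists Bot.
- by right; exists Top.
- by left; exists (Inner i).
- by left; exists Top.
- by right; exists (Inner i).
Qed.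

Lemma branch_vertexP a (w : expr_vertex (Branch a)) :
  exists k u, w = branch_copy k u.
Proof.
case: w => [||[k i]]; [exists 0%N, Bot|exists 0%N, Top|exists k, (Inner i)] => //.
Qed.

Lemma level_le e (v : expr_vertex e) : (level v <= height e)%N.
Proof.
elim: e v => [|a IHa b IHb|a IH] v; first by case: v.
- have [[u ->]|[u ->]] := series_vertexP v.
    by rewrite level_low (leq_trans (IHa u))// leq_addr.
  by rewrite level_high leq_add2l.
- by have [k [u ->]] := branch_vertexP v; rewrite level_copy IH.
Qed.

(** Only copies strictly inside the one coded by [s] contribute. *)
Lemma coef_shallow e s (v : expr_vertex e) t :
  (size t <= size s)%N -> coef s v t = 0%N.
Proof.
elim: e s v => [|a IHa b IHb|a IH] s v ts; first by case: v => // -[].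
- by have [[u ->]|[u ->]] := series_vertexP v; rewrite (coef_low,coef_high) (IHa,IHb).
- have [k [u ->]] := branch_vertexP v; rewrite coef_copy IH ?(leqW ts)//.
  by case: eqP ts => [->|]; rewrite ?muln0//= ltnn.
Qed.

Lemma coef_le e s (v : expr_vertex e) t : (coef s v t <= height e * nesting e)%N.
Proof.
elim: e s v => [|a IHa b IHb|a IH] s v; first by case: v => // -[].
- have [[u ->]|[u ->]] := series_vertexP v; rewrite (coef_low,coef_high).
    by rewrite (leq_trans (IHa _ _))// leq_mul ?leq_addr ?leq_maxl.
  by rewrite (leq_trans (IHb _ _))// leq_mul ?leq_addl ?leq_maxr.
- have [k [u ->]] := branch_vertexP v; rewrite coef_copy /= mulnS leq_add//.
  have := level_le u; rewrite /tent; case: (_ == _); rewrite ?muln0// muln1; lia.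
Qed.

Lemma total_coef_le e (v : expr_vertex e) t :
  (total_coef v t <= height e * (nesting e).+1)%N.
Proof.
rewrite mulnS leq_add ?coef_le//; have := level_le v.
by case: (_ == _); rewrite ?muln0// muln1.
Qed.

Lemma expr_adj_sym e u v : @expr_adj e u v -> expr_adj v u.
Proof.
elim: e u v => [|a IHa b IHb|a IH] u v /=.
- by case=> -[-> ->]; [right|left].
- move=> [] [u' [v' [uv -> ->]]]; [left|right]; exists v', u'; split=> //.
    exact: IHa.
  exact: IHb.
- by move=> [k [u' [v' [uv -> ->]]]]; exists k, v', u'; split=> //; exact: IH.
Qed.

Lemma level_adj e u v : @expr_adj e u v ->
  level u = (level v).+1 \/ level v = (level u).+1.
Proof.
elim: e u v => [|a IHa b IHb|a IH] u v /=.
- by case=> -[-> ->]; [right|left].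
- move=> [] [u' [v' [uv -> ->]]].
    by rewrite !level_low; exact: IHa.
  by rewrite !level_high -!addnS; case: (IHb _ _ uv) => ->; [left|right].
- by move=> [k [u' [v' [uv -> ->]]]]; rewrite !level_copy; exact: IH.
Qed.

End BundleExpr.

(** * Walks in bundle graphs *)

Section Walks.
Implicit Types (e a b : bundle_expr) (s t : seq nat).

Lemma walk_map (G H : tb_graph) (F : vertex G -> vertex H) n u v :
  (forall u v, adj u v -> adj (F u) (F v)) ->
  walk n u v -> walk n (F u) (F v).
Proof.
move=> HF; elim=> {n u v} [u|n u v w uv _ IH]; first exact: walk_nil.
by apply: walk_cons IH; exact: HF.
Qed.

Lemma walk_cat (G : tb_graph) m n (u v w : vertex G) :
  walk m u v -> walk n v w -> walk (m + n) u w.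
Proof.
elim=> {m u v} [//|m u v v' uv _ IH] /IH; exact: walk_cons.
Qed.

Lemma walk_sym (G : tb_graph) n (u v : vertex G) :
  (forall u v : vertex G, adj u v -> adj v u) -> walk n u v -> walk n v u.
Proof.
move=> sym; elim=> {n u v} [u|n u v w uv _ IH]; first exact: walk_nil.
rewrite -addn1; apply: walk_cat IH _.
by apply: (walk_cons (sym _ _ uv)); exact: walk_nil.
Qed.

Definition expr_walk e n (u v : expr_vertex e) : Prop :=
  @walk (expr_graph e) n u v.

Lemma expr_walk_sym e n (u v : expr_vertex e) : expr_walk n u v -> expr_walk n v u.
Proof. by apply: walk_sym; exact: expr_adj_sym. Qed.

Lemma walk_low a b n (u v : expr_vertex a) : expr_walk n u v ->
  expr_walk n (series_low b u) (series_low b v).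
Proof.
apply: (@walk_map (expr_graph a) (expr_graph (Series a b))).
by move=> u' v' uv; left; exists u', v'.
Qed.

Lemma walk_high a b n (u v : expr_vertex b) : expr_walk n u v ->
  expr_walk n (series_high a u) (series_high a v).
Proof.
apply: (@walk_map (expr_graph b) (expr_graph (Series a b))).
by move=> u' v' uv; right; exists u', v'.
Qed.

Lemma walk_copy a k n (u v : expr_vertex a) : expr_walk n u v ->
  expr_walk n (branch_copy k u) (branch_copy k v).
Proof.
apply: (@walk_map (expr_graph a) (expr_graph (Branch a))).
by move=> u' v' uv; exists k, u', v'.
Qed.

(** Every vertex lies on a bottom-top path whose length is the height. *)
Lemma walk_ends e (v : expr_vertex e) :
  expr_walk (level v) Bot v /\ expr_walk (height e - level v) v Top.
Proof.
elim: e v => [|a IHa b IHb|a IH] v.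
- have edge : expr_walk 1 (Bot : expr_vertex Edge) Top.
    by apply: (@walk_cons (expr_graph Edge)); [left|exact: walk_nil].
  by case: v => [||[]] /=; split=> //; exact: walk_nil.
- have [[u ->]|[u ->]] := series_vertexP v.
    have [wb wt] := IHa u; rewrite level_low; split; first exact: walk_low wb.
    have [_ wh] := IHb Bot; rewrite subn0 in wh.
    rewrite /= addnC -addnBA ?level_le// addnC.
    exact: walk_cat (walk_low _ wt) (walk_high _ wh).
  have [wb wt] := IHb u; rewrite level_high /= subnDl; split.
    have [wh _] := IHa Top.
    exact: walk_cat (walk_low _ wh) (walk_high _ wb).
  exact: walk_high wt.
- have [k [u ->]] := branch_vertexP v; have [wb wt] := IH u.
  rewrite level_copy; split; first exact: (walk_copy k wb).
  exact: (walk_copy k wt).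
Qed.

(** Vertices in series are joined by a vertical walk, with [c = 0].  Inside two
different copies of a bundle of height [H], vertices at levels [k <= l] are
joined through the bottom by a walk of length [k + l = (l - k) + 2 k] and through
the top by one of length [(l - k) + 2 (H - l)]: when [k + l <= H] the bottom is
used, with [c = k], the coefficient of the lower vertex at its own copy,
otherwise the top, with [c = H - l], that of the higher vertex at its own copy. *)
Lemma walk_coef e s (u v : expr_vertex e) :
  exists n c t, [/\ expr_walk n u v,
    (n <= (level u - level v) + (level v - level u) + 2 * c)%N,
    (c == 0)%N || (size s < size t <= size s + nesting e)%N &
    c = 0%N \/ coef s u t = (c + coef s v t)%N \/ coef s v t = (c + coef s u t)%N].
Proof.
elim: e s u v => [|a IHa b IHb|a IH] s u v.
- have [ub ut] := walk_ends u; have [vb vt] := walk_ends v.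
  case: u ub ut => [||[]] ub ut.
  + by exists (level v), 0%N, [::]; split=> //; [rewrite /=; lia|left].
  + exists (1 - level v)%N, 0%N, [::]; split=> //; [exact: expr_walk_sym|rewrite /=; lia|by left].
- have [[u' ->]|[u' ->]] := series_vertexP u; have [[v' ->]|[v' ->]] := series_vertexP v.
  + have [n [c [t [w le ct H]]]] := IHa s u' v'; exists n, c, t.
    rewrite !level_low !coef_low; split=> //; first exact: walk_low.
    case/orP: ct => [->//|/andP[-> /leq_trans->]]; rewrite ?orbT//.
    by rewrite leq_add2l /= leq_maxl.
  + have [_ ut] := walk_ends u'; have [vb _] := walk_ends v'.
    exists (height a - level u' + level v')%N, 0%N, [::]; split=> //; last by left.
      exact: walk_cat (walk_low _ ut) (walk_high _ vb).
    by have := level_le u'; rewrite level_low level_high; lia.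
  + have [_ ut] := walk_ends v'; have [vb _] := walk_ends u'.
    exists (height a - level v' + level u')%N, 0%N, [::]; split=> //; last by left.
      by apply: expr_walk_sym; exact: walk_cat (walk_low _ ut) (walk_high _ vb).
    by have := level_le v'; rewrite level_low level_high; lia.
  + have [n [c [t [w le ct H]]]] := IHb s u' v'; exists n, c, t.
    rewrite !level_high !coef_high; split=> //; [exact: walk_high|lia|].
    case/orP: ct => [->//|/andP[-> /leq_trans->]]; rewrite ?orbT//.
    by rewrite leq_add2l /= leq_maxr.
have [j [u' ->]] := branch_vertexP u; have [k [v' ->]] := branch_vertexP v.
have [<-|/eqP jk] := eqVneq j k.
  have [n [c [t [w le ct H]]]] := IH (j :: s) u' v'; exists n, c, t.
  rewrite !level_copy !coef_copy; split=> //; first exact: walk_copy.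
    by case/orP: ct => [->//|/= ?]; apply/orP; right; lia.
  have [->|c0] := eqVneq c 0%N; first by left.
  rewrite (negbTE c0) /= in ct; have -> : (t == j :: s) = false.
    by apply/eqP => tE; move: ct; rewrite tE /=; lia.
  by rewrite !muln0 !add0n.
have [ub ut] := walk_ends (branch_copy j u').
have [vb vt] := walk_ends (branch_copy k v').
have wb := walk_cat (expr_walk_sym ub) vb.
have wt := walk_cat ut (expr_walk_sym vt).
have := level_le u'; have := level_le v'; rewrite !level_copy /= in ub ut vb vt wb wt *.
have cu : coef s (branch_copy j u') (j :: s) = tent (height a) (level u').
  by rewrite coef_copy eqxx coef_shallow// muln1 addn0.
have cv : coef s (branch_copy k v') (k :: s) = tent (height a) (level v').
  by rewrite coef_copy eqxx coef_shallow// muln1 addn0.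
have cu' : coef s (branch_copy j u') (k :: s) = 0%N.
  rewrite coef_copy coef_shallow// addn0; case: eqP; rewrite ?muln0// => -[kj].
  by case: jk.
have cv' : coef s (branch_copy k v') (j :: s) = 0%N.
  rewrite coef_copy coef_shallow// addn0; case: eqP; rewrite ?muln0// => -[kj].
  by case: jk.
move=> vH uH; have sz i : (size s < size (i :: s) <= size s + (nesting a).+1)%N.
  by rewrite /=; lia.
have [low|high] := leqP (level u' + level v') (height a).
  have [uv|uv] := leqP (level u') (level v').
  + exists (level u' + level v')%N, (tent (height a) (level u')), (j :: s).
    rewrite sz orbT cu cv' addn0; split=> //; last by right; left.
    by rewrite /tent; lia.
  + exists (level u' + level v')%N, (tent (height a) (level v')), (k :: s).
    rewrite sz orbT cu' cv addn0; split=> //; last by right; right.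
    by rewrite /tent; lia.
have [uv|uv] := leqP (level u') (level v').
+ exists (height a - level u' + (height a - level v'))%N, (tent (height a) (level v')), (k :: s).
  rewrite sz orbT cu' cv addn0; split=> //; last by right; right.
  by rewrite /tent; lia.
+ exists (height a - level u' + (height a - level v'))%N, (tent (height a) (level u')), (j :: s).
  rewrite sz orbT cu cv' addn0; split=> //; last by right; left.
  by rewrite /tent; lia.
Qed.

Lemma graph_distP (G : tb_graph) (u v : vertex G) n : walk n u v ->
  walk (graph_dist u v) u v /\ (graph_dist u v <= n)%N.
Proof.
move=> w; have ex : exists m, `[< walk m u v >] by exists n; apply/asboolP.
have [wd dmin] : [set m | walk m u v /\ forall k, walk k u v -> (m <= k)%N]
    (graph_dist u v).
  rewrite /graph_dist; apply: xgetPex.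
  case: (ex_minnP ex) => m /asboolP wm min_m; exists m; split=> // k wk.
  by apply: min_m; apply/asboolP.
by split=> //; exact: dmin.
Qed.

End Walks.

(** * The embedding *)

Section BundleEmbedding.
Context {R : realType} {V : normedModType R} (y : nat -> V).
Implicit Types (e a b : bundle_expr) (s t : seq nat).

Let x s : V := y (CodeSeq.code s).

Fixpoint inner_emb e s : inner_vertex e -> V :=
  match e with
  | Edge => fun _ => 0
  | Series a b => fun i => match i with
      | inl (inl i) => inner_emb s i
      | inl (inr _) => 0
      | inr i => inner_emb s i
      end
  | Branch a => fun i =>
      (tent (height a) (inner_level i.2))%:R *: x (i.1 :: s)
      + inner_emb (i.1 :: s) i.2
  end.

Definition emb e s (v : expr_vertex e) : V :=
  if v is Inner i then inner_emb s i else 0.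

Definition bundle_emb e (v : expr_vertex e) : V :=
  (level v)%:R *: x [::] + emb [::] v.

Lemma emb_low a b s (u : expr_vertex a) : emb s (series_low b u) = emb s u.
Proof. by case: u. Qed.

Lemma emb_high a b s (u : expr_vertex b) : emb s (series_high a u) = emb s u.
Proof. by case: u. Qed.

Lemma emb_copy a k s (u : expr_vertex a) : emb s (branch_copy k u) =
  (tent (height a) (level u))%:R *: x (k :: s) + emb (k :: s) u.
Proof. by case: u => //=; rewrite ?tent0 ?tenthh scale0r addr0. Qed.

(** All the sums past some bound equal [z], so that finite expansions combine
linearly without keeping track of the codes of the nodes involved. *)
Definition expands (z : V) (c : seq nat -> R) : Prop :=
  exists N0, forall N, (N0 <= N)%N ->
    z = \sum_(i < N) c (CodeSeq.decode i) *: y i.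

Lemma expands_lin (al : R) z z' c c' : expands z c -> expands z' c' ->
  expands (al *: z + z') (fun t => al * c t + c' t).
Proof.
move=> [N zN] [N' zN']; exists (maxn N N') => M; rewrite geq_max => /andP[NM NM'].
rewrite (zN _ NM) (zN' _ NM') scaler_sumr -big_split/=.
by apply: eq_bigr => i _; rewrite scalerA scalerDl.
Qed.

Lemma expands_node t : expands (x t) (fun t' => (t' == t)%:R).
Proof.
exists (CodeSeq.code t).+1 => N tN.
rewrite (bigD1 (Ordinal tN))//= CodeSeq.codeK eqxx scale1r big1 ?addr0// => i it.
rewrite (_ : _ == _ = false) ?scale0r//; apply/eqP => tE.
by case/eqP: it; apply/val_inj; rewrite /= -tE CodeSeq.decodeK.
Qed.

Lemma expands_eq z c c' : expands z c -> c =1 c' -> expands z c'.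
Proof.
by move=> [N zN] cc'; exists N => M /zN ->; apply: eq_bigr => i _; rewrite cc'.
Qed.

Lemma expands_emb e s (v : expr_vertex e) :
  expands (emb s v) (fun t => (coef s v t)%:R).
Proof.
have expands0 : expands 0 (fun=> 0).
  by exists 0%N => N _; rewrite big1// => i _; rewrite scale0r.
elim: e s v => [|a IHa b IHb|a IH] s v; first by case: v => // -[].
- have [[u ->]|[u ->]] := series_vertexP v; rewrite ?emb_low ?emb_high.
    by apply: expands_eq (IHa s u) _ => t; rewrite coef_low.
  by apply: expands_eq (IHb s u) _ => t; rewrite coef_high.
- have [k [u ->]] := branch_vertexP v; rewrite emb_copy.
  apply: expands_eq (expands_lin _ (expands_node _) (IH _ u)) _ => t.
  by rewrite coef_copy natrD natrM.
Qed.

Lemma expands_bundle_emb e (v : expr_vertex e) :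
  expands (bundle_emb v) (fun t => (total_coef v t)%:R).
Proof.
apply: expands_eq (expands_lin _ (expands_node _) (expands_emb _ v)) _ => t.
by rewrite natrD natrM.
Qed.

Lemma adj_natr_dist (m n : nat) : m = n.+1 \/ n = m.+1 \/ m = n ->
  `|m%:R - n%:R : R| <= 1.
Proof.
case=> [->|[->|->]]; last by rewrite subrr normr0.
  by rewrite -natr1 addrAC subrr add0r normr1.
by rewrite -natr1 opprD addrA subrr add0r normrN normr1.
Qed.

Variable n : nat.
Hypothesis box_le1 : forall s z, (size s <= n)%N -> branch_box x s z -> `|z| <= 1.

(** The part [z] collects what the copies around the edge, up to the one coded by
[s], contribute to the difference; each further nesting adds one more vector
of the branch with a coefficient in [-1, 1]. *)
Lemma emb_adj e s (u v : expr_vertex e) z : expr_adj u v ->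
  (size s + nesting e <= n)%N -> branch_box x s z ->
  `|z + (emb s u - emb s v)| <= 1.
Proof.
elim: e s u v z => [|a IHa b IHb|a IH] s u v z /=.
- move=> uv; rewrite addn0 => sn zs; suff -> : emb s u - emb s v = 0.
    by rewrite addr0; exact: box_le1 zs.
  by case: uv => -[-> ->]; rewrite subrr.
- rewrite addn_maxr geq_max => -[] [u' [v' [uv -> ->]]] /andP[an bn].
    by rewrite !emb_low; exact: IHa.
  by rewrite !emb_high; exact: IHb.
- move=> [k [u' [v' [uv -> ->]]]] sn zs; rewrite !emb_copy.
  rewrite opprD addrACA -scalerBl (addrA z); apply: IH => //.
    by rewrite addSnnS.
  exists z => //.
  exists ((tent (height a) (level u'))%:R - (tent (height a) (level v'))%:R) => //=.
  apply: adj_natr_dist; have := level_adj uv; have := level_le u'; have := level_le v'.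
  by rewrite /tent; lia.
Qed.

Lemma bundle_emb_walk e k (u v : expr_vertex e) : (nesting e <= n)%N ->
  expr_walk k u v -> `|bundle_emb u - bundle_emb v| <= k%:R.
Proof.
move=> en; elim=> {k u v} [u|k u v w uv _ IH]; first by rewrite subrr normr0.
rewrite -(subrKA (bundle_emb v)) (le_trans (ler_normD _ _))// -natr1 addrC lerD//.
rewrite /bundle_emb opprD addrACA -scalerBl; apply: emb_adj => //=.
exists 0 => //; exists ((level u)%:R - (level v)%:R); rewrite ?add0r//=.
by apply: adj_natr_dist; have [->|->] := level_adj uv; [left|right; left].
Qed.

Variables (theta delta : R) (M : nat).
Hypothesis node_ge : forall s, (size s <= n)%N -> theta <= `|x s|.
Hypothesis almost_monotone : forall c : nat -> R,
  (forall i, exists p q, [/\ (p <= M)%N, (q <= M)%N & c i = p%:R - q%:R]) ->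
  forall j N, (j <= N)%N ->
    `|\sum_(i < j) c i *: y i| <= `|\sum_(i < N) c i *: y i| + delta.

Lemma bundle_emb_partial e (u v : expr_vertex e) j :
  (height e * (nesting e).+1 <= M)%N ->
  `|\sum_(i < j) ((total_coef u (CodeSeq.decode i))%:R
                  - (total_coef v (CodeSeq.decode i))%:R) *: y i|
  <= `|bundle_emb u - bundle_emb v| + delta.
Proof.
move=> eM.
have [N zN] := expands_lin (-1) (expands_bundle_emb v) (expands_bundle_emb u).
pose c i : R := (total_coef u (CodeSeq.decode i))%:R
                - (total_coef v (CodeSeq.decode i))%:R.
have -> : bundle_emb u - bundle_emb v = \sum_(i < maxn N j) c i *: y i.
  rewrite addrC -scaleN1r (zN (maxn N j)) ?leq_maxl//.
  by apply: eq_bigr => i _; rewrite mulN1r addrC.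
apply: (almost_monotone (c := c)); last exact: leq_maxr.
move=> i; exists (total_coef u (CodeSeq.decode i)), (total_coef v (CodeSeq.decode i)).
by split=> //; apply: leq_trans (total_coef_le _ _) eM.
Qed.

(** The root has code 0, so its term is the first partial sum. *)
Lemma level_bundle_emb e (u v : expr_vertex e) :
  (height e * (nesting e).+1 <= M)%N ->
  `|(level u)%:R - (level v)%:R| * theta <= `|bundle_emb u - bundle_emb v| + delta.
Proof.
move=> eM; apply: le_trans (bundle_emb_partial u v 1 eM).
rewrite big_ord1 normrZ /total_coef /= !muln1 !coef_shallow// !addn0.
by rewrite ler_wpM2l// (@node_ge [::]).
Qed.

(** A term of a sum is the difference of two consecutive partial sums. *)
Lemma coef_bundle_emb e (u v : expr_vertex e) t :
  (height e * (nesting e).+1 <= M)%N -> (0 < size t <= n)%N ->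
  `|(coef [::] u t)%:R - (coef [::] v t)%:R| * theta
    <= 2 * (`|bundle_emb u - bundle_emb v| + delta).
Proof.
move=> eM /andP[t0 tn].
have := bundle_emb_partial u v (CodeSeq.code t) eM.
have := bundle_emb_partial u v (CodeSeq.code t).+1 eM.
rewrite big_ord_recr/= CodeSeq.codeK.
have tE w : total_coef w t = coef [::] (w : expr_vertex e) t.
  by rewrite /total_coef; case: (t) t0 => //= *; rewrite muln0.
rewrite !tE; set S := \sum_(i < _) _; set c := _ - _ => le1 le2.
have : `|c *: y (CodeSeq.code t)| <= `|S + c *: y (CodeSeq.code t)| + `|S|.
  by rewrite -{1}[c *: _](addKr S) addrC (le_trans (ler_normB _ _)).
have : `|c| * theta <= `|c *: y (CodeSeq.code t)|.
  by rewrite normrZ ler_wpM2l//; exact: node_ge.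
lra.
Qed.

(** The factor 5 is 1 for the difference of the levels plus twice 2 for the
coefficient. *)
Lemma bundle_emb_lower e (u v : expr_vertex e) :
  (height e * (nesting e).+1 <= M)%N -> (nesting e <= n)%N -> 0 <= theta ->
  0 <= delta ->
  exists2 k, expr_walk k u v &
    k%:R * theta <= 5 * (`|bundle_emb u - bundle_emb v| + delta).
Proof.
move=> eM en theta0 delta0; have [k [c [t [w le ct H]]]] := walk_coef [::] u v.
exists k => //; have lev := level_bundle_emb u v eM.
have cle : c%:R * theta <= 2 * (`|bundle_emb u - bundle_emb v| + delta).
  case/orP: ct => [/eqP->|/andP[t0]]; first by rewrite mul0r mulr_ge0// addr_ge0.
  rewrite add0n => /leq_trans/(_ en) tn; have tsz : (0 < size t <= n)%N by rewrite t0.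
  have := coef_bundle_emb u v eM tsz.
  case: H => [->|[] ->]; first by rewrite !mul0r => *; rewrite mulr_ge0// addr_ge0.
    by rewrite natrD addrK ger0_norm.
  by rewrite natrD opprD addrCA subrr addr0 normrN ger0_norm.
have kle : k%:R <= `|(level u)%:R - (level v)%:R| + 2 * c%:R :> R.
  have -> : `|(level u)%:R - (level v)%:R| =
      ((level u - level v) + (level v - level u))%:R :> R.
    have [uv|/ltnW uv] := leqP (level u) (level v).
      by rewrite (eqP uv) add0n natrB// distrC ger0_norm// subr_ge0 ler_nat.
    by rewrite (eqP uv) addn0 natrB// ger0_norm// subr_ge0 ler_nat.
  by rewrite -natrM -natrD ler_nat.
have := ler_wpM2r theta0 kle; rewrite mulrDl -mulrA; lra.
Qed.

End BundleEmbedding.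

Theorem mainTheorem19 (R : realType) (X : completeNormedModType R)
    (sepX : separable (dual_space X)) (starX : property_star X)
    (eps : R) (eps_gt0 : 0 < eps)
    (G : tb_graph) (bundleG : nontrivial_bundle_graph G) :
  exists (f : vertex G -> dual_space X) (D : R),
    D < 6 + eps /\
    distortion_le (fun u v : vertex G => (graph_dist u v)%:R : R) f D.
Proof.
have [e _ [iso [[inv isoK invK] _ _ isoE]]] := bundleG.
(* These make [(theta - 5 * delta) / 5] equal to [1 / 6]. *)
pose theta : R := 11 / 12; pose delta : R := 1 / 60.
have [theta0 theta0_gt0 game0] := property_star_sign_game starX.
have theta_lt1 : theta < 1 by rewrite /theta; lra.
have game := sign_game_almost_isometric theta0_gt0 theta_lt1 game0.
pose M := (height e * (nesting e).+1)%N.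
pose A : seq R := [seq p%:R - q%:R | p <- iota 0 M.+1, q <- iota 0 M.+1].
have delta_gt0 : 0 < delta by rewrite /delta; lra.
have [y [y_ge y_box y_mono]] := tree_selection A delta_gt0 (game (nesting e).+1).
have mono (c : nat -> R) :
    (forall i, exists p q, [/\ (p <= M)%N, (q <= M)%N & c i = p%:R - q%:R]) ->
    forall j N, (j <= N)%N ->
    `|\sum_(i < j) c i *: y i| <= `|\sum_(i < N) c i *: y i| + delta.
  move=> cA; apply: y_mono => i; have [p [q [pM qM ->]]] := cA i.
  by apply/allpairsP; exists (p, q); rewrite !mem_iota !ltnS !pM.
have to_expr n (u v : vertex G) : walk n u v -> expr_walk n (iso u) (iso v).
  by apply: (@walk_map G (expr_graph e)) => u' v' /isoE.
have of_expr n (u v : vertex G) : expr_walk n (iso u) (iso v) -> walk n u v.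
  move=> w; rewrite -[u]isoK -[v]isoK.
  apply: (@walk_map (expr_graph e) G inv) w => u' v' uv.
  by apply/isoE; rewrite !invK.
exists (fun v => bundle_emb y (iso v)), 6; split; first by lra.
exists (1 / 6); first by lra.
move=> u v.
have theta_ge0 : 0 <= theta by rewrite /theta; lra.
have [k wk kle] := bundle_emb_lower y_ge mono (iso u) (iso v) (leqnn _) (leqnn _)
  theta_ge0 (ltW delta_gt0).
have [wd dk] := graph_distP (of_expr _ _ _ wk).
have fd := bundle_emb_walk y_box (leqnn _) (to_expr _ _ _ wd).
rewrite (_ : 1 / 6 * 6 = 1) ?mul1r; last by lra.
apply/andP; split=> //.
have [d0|d_gt0] := posnP (graph_dist u v); first by rewrite d0 mulr0.
have d1 : 1 <= (graph_dist u v)%:R :> R by rewrite ler1n.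
have dk' : (graph_dist u v)%:R <= k%:R :> R by rewrite ler_nat.
by move: kle; rewrite /theta /delta; lra.
Qed.
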